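(* Let $X$ be a set. The nonstandard enlargements of $X$ are exactly those functional extensions of $X$ that satisfy both principles Tran and Poss.
   Context: Convention: $X$ is a set with two distinct distinguished elements $0,1\in X$; characteristic functions take values in $\{0,1\}$, and so are regarded as functions into $X$ (or into a superset of $X$). Functional extension: a functional extension of $X$ is a proper superset ${}^{*}X\supsetneq X$ together with, for each function $f:X\to X$, a distinguished extension ${}^{*}f:{}^{*}X\to{}^{*}X$ of $f$ (so ${}^{*}f(x)=f(x)$ for $x\in X$), such that: (comp) ${}^{*}(g\circ f)={}^{*}g\circ{}^{*}f$ for all $f,g:X\to X$; (equ) ${}^{*}(\chi_{fg})=\chi_{{}^{*}f\,{}^{*}g}$ for all $f,g:X\to X$, where for two functions $\phi,\psi$ with common domain, $\chi_{\phi\psi}(z)=1$ if $\phi(z)=\psi(z)$ and $\chi_{\phi\psi}(z)=0$ otherwise; (dir) for all $\xi,\eta\in{}^{*}X$ there exist $p_1,p_2:X\to X$ and $\zeta\in{}^{*}X$ such that $\xi={}^{*}p_1(\zeta)$ and $\eta={}^{*}p_2(\zeta)$. Extension of $n$-ary functions and relations in a functional extension: for all $\xi_1,\dots,\xi_n\in{}^{*}X$ there exist $p_1,\dots,p_n:X\to X$ and $\zeta\in{}^{*}X$ with ${}^{*}p_i(\zeta)=\xi_i$. For $F:X^n\to X$ one sets ${}^{*}F(\xi_1,\dots,\xi_n)={}^{*}(F\circ(p_1,\dots,p_n))(\zeta)$, which is independent of the choice of the $p_i$ and $\zeta$. For an $n$-ary relation $R\subseteq X^n$ with characteristic function $\chi_R:X^n\to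 X$, one sets ${}^{*}R=\{(\xi_1,\dots,\xi_n)\in({}^{*}X)^n\mid{}^{*}\chi_R(\xi_1,\dots,\xi_n)=1\}$. In particular this defines ${}^{*}A\subseteq{}^{*}X$ for $A\subseteq X$. Tran: for every first-order sentence $\varphi$ in the language having a symbol for each element of $X$, each finitary function $X^n\to X$ and each finitary relation on $X$, $\varphi$ is true in $X$ if and only if it is true in ${}^{*}X$ when each element of $X$ is interpreted as itself, each function $F$ as ${}^{*}F$ and each relation $R$ as ${}^{*}R$. Poss: for every family $\mathcal{F}$ of subsets of $X$ with the finite intersection property, $\bigcap_{A\in\mathcal{F}}{}^{*}A\neq\emptyset$. Nonstandard extension: a nonstandard (i.e. complete elementary) extension of $X$ is a proper superset ${}^{*}X\supsetneq X$ together with an assignment, to all finitary functions $F$ and relations $R$ on $X$, of functions ${}^{*}F$ and relations ${}^{*}R$ of the same arity on ${}^{*}X$, such that the structure on $X$ with all its finitary functions and relations is an elementary substructure of the corresponding structure on ${}^{*}X$. A nonstandard extension is viewed as a candidate functional extension through its assignment $f\mapsto{}^{*}f$ for unary $f:X\to X$; a functional extension is viewed as a candidate nonstandard extension through the extensions ${}^{*}F$, ${}^{*}R$ given, for $F:X^n\to X$ and $R\subseteq X^n$, by ${}^{*}F(\xi_1,\dots,\xi_n)={}^{*}(F\circ(p_1,\dots,p_n))(\zeta)$ for any $p_1,\dots,p_n:X\to X$ and $\zeta\in{}^{*}X$ with ${}^{*}p_i(\zeta)=\xi_i$ for all $i$, and ${}^{*}R=\{(\xi_1,\dots,\xi_n)\in({}^{*}X)^n\mid{}^{*}\chi_R(\xi_1,\dots,\xi_n)=1\}$.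 The $S$-topology on ${}^{*}X$ is the topology having $\{{}^{*}A\mid A\subseteq X\}$ as an open basis. A nonstandard enlargement of $X$ is a nonstandard extension of $X$ whose $S$-topology is quasi-compact (every open cover has a finite subcover; no separation axiom required). *)

(* Defs.v *)
From HB Require Import structures.
From mathcomp Require Import all_boot.
From mathcomp Require Import boolp classical_sets filter topology.

Set Implicit Arguments.
Unset Strict Implicit.
Unset Printing Implicit Defensive.

Local Open Scope classical_set_scope.

(* X^n is the type of functions 'I_n -> X; arity 0 is allowed. *)
Notation power X n := ('I_n -> X).

Definition pnil (X : Type) : power X 0 :=
  fun i => match notF (ltn_ord i) with end.

Definition pcons (X : Type) (n : nat) (x : X) (v : power X n) : power X n.+1 :=
  fun i => if unlift ord0 i is Some j then v j else x.

Definition chi (T Y : Type) (y0 y1 : Y) (A : set T) (t : T) : Y :=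
  if `[< A t >] then y1 else y0.

(* An element F : X^m -> X, resp. R : set (X^m), is its own m-ary function,
   resp. relation, symbol; C is the type of constant symbols. Variables are
   well scoped: the free variables are indexed by 'I_n, and [All] binds
   variable 0, shifting the others by one. Truth is classical, so falsity,
   implication and universal quantification suffice. *)
Inductive term (X C : Type) (n : nat) : Type :=
| Var of 'I_n
| Cst of C
| App (m : nat) of (power X m -> X) & power (term X C n) m.

Inductive formula (X C : Type) : nat -> Type :=
| Eql n of term X C n & term X C n : formula X C n
| Rel n (m : nat) of set (power X m) & power (term X C n) m : formula X C n
| Bot n : formula X C n
| Imp n of formula X C n & formula X C n : formula X C n
| All n of formula X C n.+1 : formula X C n.

Notation sentence X C := (formula X C 0).

Record interpretation (X M : Type) := Interpretation {
  ifun : forall n, (power X n -> X) -> power M n -> M;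
  irel : forall n, set (power X n) -> set (power M n)
}.

Definition base_interp (X : Type) : interpretation X X :=
  Interpretation (fun n F => F) (fun n R => R).

Fixpoint eval (X C M : Type) (I : interpretation X M) (c : C -> M) (n : nat)
    (v : power M n) (t : term X C n) : M :=
  match t with
  | Var i => v i
  | Cst a => c a
  | App m F ts => ifun I F (fun i => eval I c v (ts i))
  end.

Fixpoint holds (X C M : Type) (I : interpretation X M) (c : C -> M) (n : nat)
    (phi : formula X C n) : power M n -> Prop :=
  match phi in formula _ _ n return power M n -> Prop with
  | Eql _ s t => fun v => eval I c v s = eval I c v t
  | Rel _ _ R ts => fun v => irel I R (fun i => eval I c v (ts i))
  | Bot _ => fun _ => False
  | Imp _ p q => fun v => holds I c p v -> holds I c q v
  | All _ p => fun v => forall x : M, holds I c p (pcons x v)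
  end.

(* The superset *X is a type containing a copy of X. *)
Record proper_superset (X : Type) := ProperSuperset {
  ps_sort :> Type;
  incl : X -> ps_sort;
  incl_inj : injective incl;
  incl_proper : exists xi : ps_sort, forall x : X, incl x <> xi
}.
Arguments incl {X} p x.

Section Extensions.
Context {X : Type} {S : proper_superset X}.
Implicit Types (I : interpretation X S) (A : set X) (F : set (set X)).

Definition star_set I A : set S :=
  [set xi | irel I [set a : power X 1 | A (a ord0)] (fun=> xi)].

Definition unary I (f : X -> X) : S -> S :=
  fun xi => ifun I (fun a : power X 1 => f (a ord0)) (fun=> xi).

(* Elements of X are denoted by constant symbols. *)
Definition Tran I : Prop :=
  forall phi : sentence X X,
    holds (@base_interp X) id phi (@pnil X) <->
    holds I (incl S) phi (@pnil S).

Definition Poss I : Prop :=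
  forall F, finI F id -> \bigcap_(A in F) star_set I A !=set0.

Definition no_cst (M : Type) (c : void) : M := match c with end.

Record elementary I : Prop := Elementary {
  elem_fun : forall n (G : power X n -> X) (a : power X n),
    ifun I G (incl S \o a) = incl S (G a);
  elem_rel : forall n (R : set (power X n)) (a : power X n),
    irel I R (incl S \o a) <-> R a;
  elem_holds : forall n (phi : formula X void n) (a : power X n),
    holds (@base_interp X) (@no_cst X) phi a <->
    holds I (@no_cst S) phi (incl S \o a)
}.

End Extensions.

Record nonstandard_extension (X : Type) (S : proper_superset X) :=
  NonstandardExtension {
    ns_interp :> interpretation X S;
    ns_elementary : elementary ns_interp
  }.

(* x0 and x1 are the distinguished elements 0 and 1 of X. *)
Record functional_extension (X : Type) (x0 x1 : X) (S : proper_superset X) :=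
  FunctionalExtension {
    star :> (X -> X) -> S -> S;
    star_incl : forall f x, star f (incl S x) = incl S (f x);
    star_comp : forall f g : X -> X, star (g \o f) =1 star g \o star f;
    star_equ : forall f g : X -> X,
      star (chi x0 x1 [set x | f x = g x]) =1
      chi (incl S x0) (incl S x1) [set xi | star f xi = star g xi];
    star_dir : forall xi eta : S, exists (p1 p2 : X -> X) (zeta : S),
      xi = star p1 zeta /\ eta = star p2 zeta
  }.

Section InterpOf.
Context {X : Type} {x0 x1 : X} {S : proper_superset X}.
Variable E : functional_extension x0 x1 S.

Lemma joint_rep (n : nat) (xi : power S n) :
  exists pz : power (X -> X) n * S, forall i, E (pz.1 i) pz.2 = xi i.
Proof.
elim: n xi => [|n IHn] xi.
  by exists (@pnil (X -> X), incl S x0) => -[].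
have [[p z] /= pz] := IHn (xi \o lift ord0).
have [q1 [q2 [w [q1w q2w]]]] := star_dir E (xi ord0) z.
exists (pcons q1 (fun j => p j \o q2), w) => i /=; rewrite /pcons.
case: unliftP => [j ->|->]; last by rewrite -q1w.
by rewrite star_comp /= -q2w pz.
Qed.

Definition ext_fun (n : nat) (F : power X n -> X) (xi : power S n) : S :=
  let pz := projT1 (cid (joint_rep xi)) in
  E (fun x => F (fun i => pz.1 i x)) pz.2.

Definition ext_rel (n : nat) (R : set (power X n)) : set (power S n) :=
  [set xi | ext_fun (chi x0 x1 R) xi = incl S x1].

Definition interp_of : interpretation X S := Interpretation ext_fun ext_rel.

Lemma star_id xi : E id xi = xi.
Proof.
have [p [_ [z [-> _]]]] := star_dir E xi xi.
by rewrite -[LHS]/((E id \o E p) z) -star_comp.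
Qed.

Lemma star_cst c xi : E (fun=> c) xi = incl S c.
Proof.
have e1 : E (fun=> x1) xi = incl S x1.
  have -> : (fun=> x1) = chi x0 x1 [set x : X | id x = id x].
    by apply/funext => x; rewrite /chi asboolT.
  by rewrite star_equ /chi asboolT.
by rewrite -(star_incl E (fun=> c) x1) -e1 -[RHS]/((E _ \o E _) xi) -star_comp.
Qed.

Hypothesis x01 : x0 <> x1.

Lemma star_retract (f g : X -> X) xi : E f xi = E g xi ->
  exists2 a : X -> X, E a xi = xi & f \o a = g \o a.
Proof.
move=> fg; pose A := [set x | f x = g x].
have EA : E (chi x0 x1 A) xi = incl S x1 by rewrite star_equ /chi asboolT.
have [[c Ac]|A0] := pselect (exists c, A c); last first.
  case: x01; apply: (@incl_inj _ S); rewrite -EA -(star_cst x0 xi).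
  congr (E _ xi); apply/funext => x; rewrite /chi asboolF // => Ax.
  by apply: A0; exists x.
pose a x := if `[< A x >] then x else c.
exists a; last first.
  by apply/funext => x /=; rewrite /a; case: asboolP => // Ax.
have aA : chi x0 x1 A = chi x0 x1 [set x | a x = id x].
  apply/funext => x; rewrite /chi; congr (if _ then _ else _).
  apply/asboolP/asboolP => /=; rewrite /a; first by move=> Ax; rewrite asboolT.
  by case: asboolP => // _ <-.
move: EA; rewrite aA star_equ /chi; case: asboolP => [/= -> _|_ x01'].
  exact: star_id.
by case: x01; apply: incl_inj x01'.
Qed.

(* The choice of the p_i and of zeta made in [ext_fun] is immaterial. *)
Lemma ext_funE (n : nat) (F : power X n -> X) (p : power (X -> X) n) (z : S) :
  ext_fun F (fun i => E (p i) z) = E (fun x => F (fun i => p i x)) z.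
Proof.
rewrite /ext_fun; case: cid => -[q w] /= qw.
have [r [s [t [wr zs]]]] := star_dir E w z; subst w z; rewrite /=.
have {}qw i : E (q i \o r) t = E (p i \o s) t by rewrite !star_comp; apply: qw.
have [a at_ aqp] : exists2 a : X -> X, E a t = t &
    forall i, i \in enum 'I_n -> q i \o r \o a = p i \o s \o a.
  elim: (enum _) => [|i l [a ata IHl]]; first by exists id => //; exact: star_id.
  have [|b btb Hb] := @star_retract (q i \o r \o a) (p i \o s \o a) t.
    by rewrite star_comp [RHS]star_comp /= ata.
  exists (a \o b); first by rewrite star_comp /= btb.
  move=> j; rewrite inE => /orP[/eqP->//|/IHl Hj].
  by rewrite -[LHS]/((q j \o r \o a) \o b) Hj.
rewrite -[LHS]/((E _ \o E r) t) -[RHS]/((E _ \o E s) t) -!star_comp.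
rewrite -at_ -[LHS]/((E _ \o E a) t) -[RHS]/((E _ \o E a) t) -!star_comp.
congr (E _ t); apply/funext => x /=; congr F; apply/funext => i.
by have /(congr1 (@^~ x)) := aqp i (mem_enum _ _).
Qed.

End InterpOf.

Definition s_space (X : Type) (S : proper_superset X)
  (N : nonstandard_extension S) : Type := S.

Section STopology.
Context {X : Type} {S : proper_superset X} (N : nonstandard_extension S).

HB.instance Definition _ := gen_eqMixin (s_space N).
HB.instance Definition _ := gen_choiceMixin (s_space N).

Definition mem_formula (A : set X) : formula X void 1 :=
  Rel [set a : power X 1 | A (a ord0)] (fun=> Var X void ord0).

Lemma transfer1 (phi : formula X void 1) :
  (forall x, holds (@base_interp X) (@no_cst X) phi (pcons x (@pnil X))) ->
  forall xi : S, holds N (@no_cst S) phi (fun=> xi).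
Proof.
move=> H xi; have K := (elem_holds (ns_elementary N) (All phi) (@pnil X)).1 H xi.
suff <- : pcons xi (incl S \o @pnil X) = (fun=> xi) by [].
apply/funext => i; rewrite ord1 /pcons.
by case: unliftP => // j /(congr1 val).
Qed.

Lemma s_base_cover :
  \bigcup_(A in @setT (set X)) (star_set N A : set (s_space N)) = setT.
Proof.
apply/seteqP; split=> // xi _; exists setT => //.
exact: (@transfer1 (mem_formula setT)).
Qed.

Lemma s_base_join (A B : set X) (xi : s_space N) :
  setT A -> setT B -> star_set N A xi -> star_set N B xi ->
  exists C, [/\ setT C, star_set N C xi &
    star_set N C `<=` star_set N A `&` star_set N B].
Proof.
move=> _ _ Axi Bxi; exists (A `&` B); split=> //.
  exact: (@transfer1 (Imp (mem_formula A)
    (Imp (mem_formula B) (mem_formula (A `&` B)))) _ xi).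
have HA x : holds (@base_interp X) (@no_cst X)
  (Imp (mem_formula (A `&` B)) (mem_formula A)) (pcons x (@pnil X)) by move=> /= [].
have HB x : holds (@base_interp X) (@no_cst X)
  (Imp (mem_formula (A `&` B)) (mem_formula B)) (pcons x (@pnil X)) by move=> /= [].
by move=> eta ABeta; split; [apply: (transfer1 HA)|apply: (transfer1 HB)].
Qed.

HB.instance Definition _ := isBaseTopological.Build (s_space N)
  s_base_cover s_base_join.

Lemma s_openE (U : set (s_space N)) :
  open U <-> exists F : set (set X), U = \bigcup_(A in F) star_set N A.
Proof.
split=> [[F _ <-]|[F ->]]; first by exists F.
by exists F.
Qed.

End STopology.

Definition enlargement (X : Type) (S : proper_superset X)
  (N : nonstandard_extension S) : Prop := cover_compact [set: s_space N].

(* Main.v *)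
(** From an enlargement to a functional extension, the only clause that is not
    plain transfer is (dir).  A proper elementary extension forces [X] to be
    infinite, so there is an injection [f : X -> X -> X] with projections [p1]
    and [p2]; then [zeta := *f(xi, eta)] works, because [p1 (f x y) = x]
    transfers.  Since composition transfers too, the extension of an n-ary
    function is determined by the unary ones, and both interpretations agree.

    Conversely, substituting constants for parameters turns Tran into
    elementarity.  The sets [A] with [xi] in [*A] form an ultrafilter on [X], so
    [*(~A)] is the complement of [*A]; passing to complements then exchanges
    finite subcovers with the finite intersection property, which makes Poss
    and quasi-compactness of the S-topology equivalent. *)
From mathcomp Require Import finmap functions cardinality filter topology.
Require Import Defs.
From mathcomp Require Import all_boot boolp classical_sets.

Set Implicit Arguments.
Unset Strict Implicit.
Unset Printing Implicit Defensive.

Local Open Scope classical_set_scope.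

(** * Pairing on an infinite set *)

Section PartialInjections.
Variables T U : Type.
Implicit Types G : set (T * U).

(** A single equivalence says both that [G] is single-valued and that it is injective. *)
Definition partial_inj G :=
  forall p q, G p -> G q -> p.1 = q.1 <-> p.2 = q.2.

Lemma partial_inj_bigcup (F : set (set (T * U))) :
  F `<=` partial_inj -> total_on F subset ->
  partial_inj (\bigcup_(G in F) G).
Proof.
move=> Fp Ft p q [G FG Gp] [H FH Hq].
have [GH|HG] := Ft _ _ FG FH.
- by apply: (Fp H) => //; apply: GH.
- by apply: (Fp G) => //; apply: HG.
Qed.

End PartialInjections.

Section SquareInjection.
Variable X : Type.
Implicit Types (A B : set X) (G : set ((X * X) * X)).

Lemma inj_comparable A B :
  (exists h : X -> X, set_fun A B h /\ set_inj A h) \/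
  (exists h : X -> X, set_fun B A h /\ set_inj B h).
Proof.
pose P := [set G : set (X * X) | partial_inj G /\ G `<=` A `*` B].
have [|G [[Gp GAB] Gmax]] := @Zorn_bigcup _ P.
  move=> F FP Ft; split; last by move=> p [G /FP[_]]; apply.
  by apply: partial_inj_bigcup => // G /FP[].
have [Gdom|/existsNP[a /not_implyP[Aa Ga]]] :=
    pselect (forall a, A a -> exists b, G (a, b)).
  left; have /choice[h hG] : forall a, exists b, A a -> G (a, b).
    move=> a; have [/Gdom[b Gab]|nAa] := pselect (A a); first by exists b.
    by exists a.
  exists h; split=> [a /hG/GAB[]//|a b /set_mem/hG Ga /set_mem/hG Gb e].
  exact: (Gp _ _ Ga Gb).2 e.
have [Gran|/existsNP[b /not_implyP[Bb Gb]]] :=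
    pselect (forall b, B b -> exists a, G (a, b)).
  right; have /choice[h hG] : forall b, exists a, B b -> G (a, b).
    move=> b; have [/Gran[c Gcb]|nBb] := pselect (B b); first by exists c.
    by exists b.
  exists h; split=> [x /hG/GAB[]//|x y /set_mem/hG Gx /set_mem/hG Gy e].
  exact: (Gp _ _ Gx Gy).1 e.
case: (Gmax (G `|` [set (a, b)])).
  split; first by left.
  by move=> /(_ (a, b) (or_intror erefl)) Gab; apply: Ga; exists b.
split=> [|p [/GAB//|->//]].
move=> p q [Gp'|->] [Gq|->] //=; first exact: Gp.
- case: p Gp' => u v Guv /=.
  by split=> e; subst; [case: Ga; exists v|case: Gb; exists u].
- case: q Gq => u v Guv /=.
  by split=> e; subst; [case: Ga; exists v|case: Gb; exists u].
Qed.

(** The carrier [D] is read off the diagonal, so an injection of [D * D] into [D] is a bare set of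
    triples and Zorn applies to unions. *)
Definition diag_dom G : set X := [set a | exists c, G (a, a, c)].

Definition square_inj G := [/\ partial_inj G,
  forall a b, diag_dom G a -> diag_dom G b -> exists c, G (a, b, c) &
  forall a b c, G (a, b, c) -> [/\ diag_dom G a, diag_dom G b & diag_dom G c]].

Lemma diag_domS G H : G `<=` H -> diag_dom G `<=` diag_dom H.
Proof. by move=> GH a [c /GH]; exists c. Qed.

Lemma square_inj_bigcup (F : set (set (X * X * X))) :
  F `<=` square_inj -> total_on F subset ->
  square_inj (\bigcup_(G in F) G).
Proof.
move=> Fs Ft; split; first by apply: partial_inj_bigcup => // G /Fs[].
- move=> a b [c [G FG Gc]] [d [H FH Hd]].
  have [K [FK GK HK]] : exists K, [/\ F K, G `<=` K & H `<=` K].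
    by have [GH|HG] := Ft _ _ FG FH; [exists H; split|exists G; split].
  have [_ Ksq _] := Fs _ FK.
  have [||e Ke] := Ksq a b; [by exists c; apply: GK|by exists d; apply: HK|].
  by exists e, K.
- move=> a b c [G FG Gabc]; have [_ _ Gd] := Fs _ FG.
  have sub : G `<=` \bigcup_(G in F) G by move=> p Gp; exists G.
  by have [] := Gd _ _ _ Gabc; split; apply: (diag_domS sub).
Qed.

Lemma square_inj_nat (e : nat -> X) : injective e ->
  square_inj [set ((e mn.1, e mn.2), e (pickle mn)) | mn in [set: nat * nat]].
Proof.
move=> einj; set G := [set _ | _ in _].
have GD n : diag_dom G (e n) by exists (e (pickle (n, n))), (n, n).
split.
- move=> _ _ [[m n] _ <-] [[m' n'] _ <-] /=; split=> [[/einj-> /einj->]//|].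
  by move=> /einj/(pcan_inj pickleK)[-> ->].
- move=> _ _ [_ [[m m'] _ [<- _ _]]] [_ [[n n'] _ [<- _ _]]].
  by exists (e (pickle (m, n))), (m, n).
- by move=> _ _ _ [[m n] _ [<- <- <-]].
Qed.

(** The classical proof that an infinite cardinal is its own square: take a maximal injection of
    [D * D] into [D], then compare [D] with its complement. *)
Lemma square_injection (e : nat -> X) : injective e ->
  exists f : X -> X -> X, forall a b a' b', f a b = f a' b' -> a = a' /\ b = b'.
Proof.
move=> einj.
pose G0 := [set ((e mn.1, e mn.2), e (pickle mn)) | mn in [set: nat * nat]].
(* [G0] keeps the empty chain from making the maximal relation trivial. *)
pose P := [set G | square_inj (G0 `|` G)].
have [|G [PG Gmax]] := @Zorn_bigcup _ P.
  move=> F FP Ft; rewrite /P /=.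
  (* Listing [G0] itself as a member keeps this identity true for the empty chain. *)
  have -> : G0 `|` \bigcup_(G in F) G =
      \bigcup_(H in [set G0 `|` G | G in F] `|` [set G0]) H.
    apply/seteqP; split=> p; first case=> [G0p|[G FG Gp]].
    - by exists G0 => //; right.
    - by exists (G0 `|` G); [left; exists G|right].
    - case=> _ [[G FG <-]|->] => [[]|]; [by left|by right; exists G|by left].
  apply: square_inj_bigcup => [_ [[G /FP ? <-]//|->]|].
    exact: square_inj_nat.
  move=> _ _ [[G FG <-]|->] [[H FH <-]|->].
  - have [GH|HG] := Ft _ _ FG FH; [left|right]; exact: setUS.
  - by right; left.
  - by left; left.
  - by left.
set M := G0 `|` G in PG; have [Mp Msq MD] := PG; pose D := diag_dom M.
have eD n : D (e n).
  by exists (e (pickle (n, n))); left; exists (n, n).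
have [f fM] : exists f : X -> X -> X, forall a b, D a -> D b -> M (a, b, f a b).
  have /choice[f fP] : forall p : X * X, exists c, D p.1 -> D p.2 -> M (p, c).
    case=> a b; have [[Da Db]|nDab] := pselect (D a /\ D b).
      by have [c Mc] := Msq a b Da Db; exists c.
    by exists a => Da Db; case: nDab.
  by exists (fun a b => f (a, b)) => a b; apply: (fP (a, b)).
have fD a b : D a -> D b -> D (f a b).
  by move=> Da Db; have [] := MD _ _ _ (fM _ _ Da Db).
have finj a b a' b' : D a -> D b -> D a' -> D b' ->
    f a b = f a' b' -> a = a' /\ b = b'.
  by move=> Da Db Da' Db' /(Mp _ _ (fM _ _ Da Db) (fM _ _ Da' Db')).2[].
(* Two copies of [D] fit into [D], tagged by [e 0] and [e 1]. *)
have double (E : set X) (h : X -> X) :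
    (forall x, E x -> ~ D x -> D (h x)) ->
    (forall x y, E x -> ~ D x -> E y -> ~ D y -> h x = h y -> x = y) ->
    exists k : X -> X, [/\ forall x, E x -> D (k x) &
      forall x y, E x -> E y -> k x = k y -> x = y].
  move=> hD hinj.
  exists (fun x => if `[< D x >] then f x (e 0) else f (h x) (e 1)); split.
    by move=> x Ex; case: asboolP => Dx; apply: fD => //; apply: hD.
  move=> x y Ex Ey; case: asboolP => Dx; case: asboolP => Dy /finj[] //.
  - by move/hD: Dy; apply.
  - by move=> _ /einj.
  - by apply: hD.
  - by move=> _ /einj.
  - by apply: hD.
  - by apply: hD.
  - by move=> /hinj ->.
have [[h [hD hinj]]|[h [hD hinj]]] := inj_comparable (~` D) D.
  have [x _ nDx|x y _ nDx _ nDy|k [kD kinj]] := double setT h.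
  - exact: hD.
  - by apply: hinj; apply: mem_set.
  exists (fun a b => f (k a) (k b)) => a b a' b' /finj[]; try exact: kD.
  by move=> /kinj-> // /kinj->.
(* Otherwise [~` D] contains a copy of [D], which absorbs the new part of the
   square of [D `|` h @` D], against the maximality of [M]. *)
have hinj' x y : D x -> D y -> h x = h y -> x = y.
  by move=> Dx Dy; apply: hinj; apply: mem_set.
pose E := D `|` h @` D.
have /choice[g gh] : forall x, exists y, (h @` D) x -> D y /\ h y = x.
  move=> x; have [[y Dy <-]|nx] := pselect ((h @` D) x); first by exists y.
  by exists x.
have [x [//|Ex] _|x y [//|Ex] _ [//|Ey] _ gxy|k [kD kinj]] := double E g.
- by have [] := gh x Ex.
- by have [_ <-] := gh x Ex; have [_ <-] := gh y Ey; rewrite gxy.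
(* Old pairs keep their values in [D]; [h] sends the values of new pairs outside [D], so the two
   kinds never collide. *)
pose M' := M `|` [set p | [/\ E p.1.1, E p.1.2, ~ (D p.1.1 /\ D p.1.2) &
  p.2 = h (f (k p.1.1) (k p.1.2))]].
have kfD a b : E a -> E b -> D (f (k a) (k b)).
  by move=> Ea Eb; apply: fD; apply: kD.
have M'D x : E x -> diag_dom M' x.
  move=> Ex; have [[c Mc]|nDx] := pselect (D x); first by exists c; left.
  by exists (h (f (k x) (k x))); right; split=> //= -[].
have M'E x : diag_dom M' x -> E x.
  by case=> c [Mc|[]//]; left; exists c.
case: (Gmax M').
  split=> [p Gp|M'G]; first by left; right.
  (* [h (e 0)] lies in [E] but not in [D], so its diagonal triple is new. *)
  have : M' (h (e 0), h (e 0), h (f (k (h (e 0))) (k (h (e 0))))).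
    right.
    split=> //=; [by right; exists (e 0)..|].
    by case=> /(hD _ (eD 0)).
  move=> /M'G Gh; suff : D (h (e 0)) by exact: hD.
  by exists (h (f (k (h (e 0))) (k (h (e 0))))); right.
rewrite /P /= (_ : G0 `|` M' = M'); last by apply/setUidPr => p G0p; left; left.
split.
- move=> [[a b] c] [[a' b'] c'].
  move=> [Mc|[/= Ea Eb nD ->]] [Mc'|[/= Ea' Eb' nD' ->]] /=.
  + exact: (Mp _ _ Mc Mc').
  + have [Da Db Dc] := MD _ _ _ Mc.
    split=> [[aa bb]|cc]; first by subst; case: nD'.
    by subst c; case: (hD _ (kfD _ _ Ea' Eb')).
  + have [Da Db Dc] := MD _ _ _ Mc'.
    split=> [[aa bb]|cc]; first by subst; case: nD.
    by subst c'; case: (hD _ (kfD _ _ Ea Eb)).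
  + split=> [[-> ->]//|/hinj'/finj[]]; try exact: kfD; try exact: kD.
    by move=> /kinj-> // /kinj->.
- move=> a b /M'E Ea /M'E Eb.
  have [[Da Db]|nD] := pselect (D a /\ D b).
    by have [c Mc] := Msq a b Da Db; exists c; left.
  by exists (h (f (k a) (k b))); right.
- move=> a b c [Mc|[/= Ea Eb _ ->]].
    by have [Da Db Dc] := MD _ _ _ Mc; split; apply: M'D; left.
  by split; apply: M'D => //; right; exists (f (k a) (k b)) => //; apply: kfD.
Qed.

End SquareInjection.

(** * Transfer and elementarity *)

Section Translation.
Variables X C C' : Type.

(* Names of elements of [X] become nullary functions, so that constants and
   parameters can be exchanged without renaming under binders. *)
Definition atom m (u : 'I_m + X) : term X C' m :=
  match u with
  | inl i => Var X C' i
  | inr x => App (fun=> x) (@pnil (term X C' m))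
  end.

Definition lift_atom n m (s : 'I_n -> 'I_m + X) : 'I_n.+1 -> 'I_m.+1 + X :=
  pcons (inl ord0) (fun i => match s i with
                             | inl j => inl (lift ord0 j)
                             | inr x => inr x
                             end).

Fixpoint translate_term (k : C -> X) n m (s : 'I_n -> 'I_m + X)
    (t : term X C n) : term X C' m :=
  match t with
  | Var i => atom (s i)
  | Cst c => atom (inr (k c))
  | App p F ts => App F (fun i => translate_term k s (ts i))
  end.

(** The target scope [m] is quantified after [phi] because [All] enlarges it in the recursive
    call. *)
Fixpoint translate (k : C -> X) n (phi : formula X C n) :
    forall m, ('I_n -> 'I_m + X) -> formula X C' m :=
  match phi in formula _ _ n
    return forall m, ('I_n -> 'I_m + X) -> formula X C' m with
  | Eql _ t u => fun m s => Eql (translate_term k s t) (translate_term k s u)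
  | Rel _ _ R ts => fun m s => Rel R (fun i => translate_term k s (ts i))
  | Bot _ => fun m _ => Bot X C' m
  | Imp _ p q => fun m s => Imp (translate k p s) (translate k q s)
  | All _ p => fun m s => All (translate k p (lift_atom s))
  end.

Variables (M : Type) (I : interpretation X M) (j : X -> M).
Hypothesis Ij : forall x v, ifun I (fun _ : power X 0 => x) v = j x.
Variables (k : C -> X) (c' : C' -> M).

Definition atom_val m (v : power M m) (u : 'I_m + X) : M :=
  match u with inl i => v i | inr x => j x end.

Lemma eval_atom m (v : power M m) u : eval I c' v (atom u) = atom_val v u.
Proof. by case: u => //= x; rewrite Ij. Qed.

Lemma eval_translate n m (s : 'I_n -> 'I_m + X) (v : power M m) t :
  eval I c' v (translate_term k s t) =
  eval I (j \o k) (fun i => atom_val v (s i)) t.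
Proof.
elim: t => [i|c|p F ts IHt] /=; [exact: eval_atom|by rewrite Ij|].
by congr (ifun I F _); apply/funext.
Qed.

Lemma atom_val_lift n m (s : 'I_n -> 'I_m + X) (v : power M m) x :
  (fun i => atom_val (pcons x v) (lift_atom s i)) =
  pcons x (fun i => atom_val v (s i)).
Proof.
apply/funext => i; rewrite /lift_atom /pcons.
case: unliftP => [l _|_] /=; last by rewrite unlift_none.
by case: (s l) => //= l'; rewrite liftK.
Qed.

Lemma holds_translate n (phi : formula X C n) m (s : 'I_n -> 'I_m + X)
    (v : power M m) :
  holds I c' (translate k phi s) v <->
  holds I (j \o k) phi (fun i => atom_val v (s i)).
Proof.
elim: phi m s v => {n} [n t u|n p R ts|//|n p IHp q IHq|n p IHp] m s v /=.
- by rewrite !eval_translate.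
- by under eq_fun do rewrite eval_translate.
- by rewrite IHp IHq.
- by split=> H x; have := H x; rewrite IHp atom_val_lift.
Qed.

End Translation.

Lemma incl_pnil (X : Type) (S : proper_superset X) (v : power S 0) :
  incl S \o @pnil X = v.
Proof. by apply/funext => -[]. Qed.

Lemma ifun_nullary (X : Type) (S : proper_superset X) (I : interpretation X S) :
  elementary I -> forall x v, ifun I (fun _ : power X 0 => x) v = incl S x.
Proof. by move=> el x v; rewrite -(incl_pnil v) (elem_fun el). Qed.

Lemma elementary_Tran (X : Type) (S : proper_superset X)
  (I : interpretation X S) : elementary I -> Tran I.
Proof.
move=> el phi; pose psi := translate void id phi (fun i : 'I_0 => inl i).
have base := @holds_translate X X void X (base_interp X) id (fun _ _ => erefl)
  id (@no_cst X) _ phi _ (fun i : 'I_0 => inl i) (@pnil X).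
have star := @holds_translate X X void S I (incl S) (ifun_nullary el)
  id (@no_cst S) _ phi _ (fun i : 'I_0 => inl i) (@pnil S).
apply: iff_trans (iff_sym base) (iff_trans _ star).
by rewrite -(incl_pnil (@pnil S)); exact: (elem_holds el).
Qed.

(** * From Tran to elementarity for a functional extension *)

Section OfFunctional.
Variables (X : Type) (x0 x1 : X) (x01 : x0 <> x1) (S : proper_superset X).
Variable E : functional_extension x0 x1 S.

Lemma ext_fun_incl n (F : power X n -> X) (a : power X n) :
  ext_fun E F (incl S \o a) = incl S (F a).
Proof.
(* Constant functions represent standard arguments; the base point [incl S x0] is arbitrary. *)
have := ext_funE E x01 F (fun i _ => a i) (incl S x0).
rewrite star_cst => <-; congr ext_fun; apply/funext => i /=.
by rewrite star_cst.
Qed.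

Lemma Tran_elementary : Tran (interp_of E) -> elementary (interp_of E).
Proof.
move=> tran; split.
- exact: ext_fun_incl.
- move=> n R a; rewrite /= /ext_rel /= ext_fun_incl /chi.
  by case: asboolP => Ra; split=> // e; case: x01; apply: incl_inj e.
(* Each free variable is replaced by the name of its parameter, which leaves a sentence for Tran. *)
- move=> n phi a; pose s i : 'I_0 + X := inr (a i).
  have nul x v : ext_fun E (fun _ : power X 0 => x) v = incl S x.
    by rewrite -(incl_pnil v) ext_fun_incl.
  have base := @holds_translate X void X X (base_interp X) id (fun _ _ => erefl)
    (@no_cst X) id _ phi _ s (@pnil X).
  have star := @holds_translate X void X S (interp_of E) (incl S) nul
    (@no_cst X) (incl S) _ phi _ s (@pnil S).
  have no (M : Type) (f g : void -> M) : f = g by apply/funext.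
  move: base star.
  rewrite (no _ (id \o _) (@no_cst X)) (no _ (incl S \o _) (@no_cst S)).
  by move=> <- <-; exact: tran.
Qed.

Lemma unary_interp_of : unary (interp_of E) = star E.
Proof.
apply/funext => f; apply/funext => xi; rewrite /unary /=.
have := ext_funE E x01 (fun a : power X 1 => f (a ord0)) (fun=> id) xi.
by rewrite star_id.
Qed.

End OfFunctional.

(** * The functional extension carried by a nonstandard extension *)

Section OfNonstandard.
Variables (X : Type) (S : proper_superset X).
Variable N : nonstandard_extension S.
Let el := ns_elementary N.

(** Elementarity allows standard parameters only; closing [phi] universally, one variable at a time,
    reaches arbitrary points of [S]. *)
Lemma transfer n (phi : formula X void n) :
  (forall v, holds (base_interp X) (@no_cst X) phi v) ->
  forall v, holds N (@no_cst S) phi v.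
Proof.
elim: n phi => [|n IHn] phi H v.
  by rewrite -(incl_pnil v); apply/(elem_holds el); apply: H.
have -> : v = pcons (v ord0) (v \o lift ord0).
  by apply/funext => i; rewrite /pcons; case: unliftP => [j|] ->.
by apply: (IHn (All phi)) => w x; apply: H.
Qed.

Definition fn1 C n (f : X -> X) (t : term X C n) : term X C n :=
  App (fun a : power X 1 => f (a ord0)) (fun=> t).

Definition cst0 n (x : X) : term X void n := atom void (inr x).

Lemma eval_cst0 n (v : power S n) x :
  eval N (@no_cst S) v (cst0 n x) = incl S x.
Proof. exact: ifun_nullary. Qed.

Lemma unary_incl f x : unary N f (incl S x) = incl S (f x).
Proof. exact: (elem_fun el _ (fun=> x)). Qed.

Lemma unary_comp f g : unary N (g \o f) =1 unary N g \o unary N f.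
Proof.
move=> xi; pose x := Var X void (@ord0 0).
by apply: (@transfer 1 (Eql (fn1 (g \o f) x) (fn1 g (fn1 f x))) _ (fun=> xi)).
Qed.

Lemma unary_equ x0 x1 f g : unary N (chi x0 x1 [set x | f x = g x]) =1
  chi (incl S x0) (incl S x1) [set xi | unary N f xi = unary N g xi].
Proof.
move=> xi; pose x := Var X void (@ord0 0).
pose h := chi x0 x1 [set x | f x = g x].
pose eq := Eql (fn1 f x) (fn1 g x).
have e1 := @transfer 1 (Imp eq (Eql (fn1 h x) (cst0 1 x1))) _ (fun=> xi).
have e0 := @transfer 1 (Imp (Imp eq (Bot _ _ _)) (Eql (fn1 h x) (cst0 1 x0)))
  _ (fun=> xi).
rewrite /chi; case: asboolP => /= [fg|nfg].
  rewrite -(@eval_cst0 1 (fun=> xi)); apply: e1 => //= v ev.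
  by rewrite /h /chi asboolT.
rewrite -(@eval_cst0 1 (fun=> xi)); apply: e0 => //= v ev.
by rewrite /h /chi asboolF.
Qed.

Lemma ifun_unary n m (F : power X n -> X) (p : 'I_n -> power X m -> X)
    (xi : power S m) :
  ifun N F (fun i => ifun N (p i) xi) = ifun N (fun a => F (fun i => p i a)) xi.
Proof.
pose vs := fun i : 'I_m => Var X void i.
exact: (@transfer m (Eql (App F (fun i => App (p i) vs))
  (App (fun a => F (fun i => p i a)) vs)) _ xi).
Qed.

Lemma irel_chi x0 x1 n (R : set (power X n)) (xi : power S n) : x0 <> x1 ->
  irel N R xi <-> ifun N (chi x0 x1 R) xi = incl S x1.
Proof.
move=> x01; pose vs := fun i : 'I_n => Var X void i.
pose eq := Eql (App (chi x0 x1 R) vs) (cst0 n x1).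
rewrite -(@eval_cst0 n xi); split.
  apply: (@transfer n (Imp (Rel R vs) eq) _ xi) => v /= Rv.
  by rewrite /chi asboolT.
apply: (@transfer n (Imp eq (Rel R vs)) _ xi) => v /=.
by rewrite /chi; case: asboolP.
Qed.

(** Otherwise the statement that every point is some [a i] would transfer to [S], against
    properness. Length zero yields a point of [X]. *)
Lemma base_not_surjected n (a : power X n) : exists x, forall i, x <> a i.
Proof.
apply: contrapT => /forallNP H.
have {}H x : exists i, x = a i.
  by have /existsNP[i /contrapT] := H x; exists i.
pose neq (i : 'I_n) : formula X void n.+1 :=
  Imp (Eql (Var X void ord0) (Var X void (lift ord0 i))) (Bot _ _ _).
(* A disjunction of equalities, written as a chain of negated hypotheses ending in falsity. *)
pose phi : formula X void n :=
  All (foldr (fun i => Imp (neq i)) (Bot _ _ _) (enum 'I_n)).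
have phiE M (I : interpretation X M) (b : power M n) :
    holds I (@no_cst M) phi b <-> forall x, exists i, x = b i.
  suff K x s : holds I (@no_cst M) (foldr (fun i => Imp (neq i)) (Bot _ _ _) s)
      (pcons x b) <-> exists2 i, i \in s & x = b i.
    split=> Hx x; first by have [i _] := (K x _).1 (Hx x); exists i.
    by apply/(K x); have [i] := Hx x; exists i; rewrite ?mem_enum.
  have b0 : pcons x b ord0 = x by rewrite /pcons unlift_none.
  have bS i : pcons x b (lift ord0 i) = b i by rewrite /pcons liftK.
  elim: s => [|i s IHs] /=; first by split=> // -[].
  rewrite b0 bS IHs; split.
    have [->|xi] := pselect (x = b i); first by exists i; rewrite ?mem_head.
    by move=> /(_ xi)[l ls]; exists l; rewrite // inE ls orbT.
  case=> l; rewrite inE => /orP[/eqP->|ls] xl nx; first by case: nx.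
  by exists l.
have [xi nxi] := incl_proper S.
have [i xii] := (phiE _ _ _).1 ((elem_holds el phi a).1 ((phiE _ _ _).2 H)) xi.
exact: (nxi (a i)).
Qed.

Lemma nat_injection : exists e : nat -> X, injective e.
Proof.
have [x0 _] := base_not_surjected (@pnil X).
have Xinf : infinite_set [set: X].
  move=> /finite_set_leP[n /pcard_leP/injfunPex[f fn finj]].
  (* [a] inverts [f], hence lists all of [X]; indices outside the image get [x0]. *)
  have /choice[a aP] : forall i : 'I_n, exists x, forall y, f y = i -> y = x.
    move=> i; have [[x fx]|nx] := pselect (exists x, f x = i).
      by exists x => y fy; apply: finj; rewrite ?in_setT// fy.
    by exists x0 => y fy; case: nx; exists y.
  have [x xa] := base_not_surjected a.
  by apply: (xa (Ordinal (fn x I))); apply: aP.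
have /card_leP/unsquash f := (infiniteP _).1 Xinf.
exists (fun n => val (f (SigSub (mem_set (I : [set: nat] n))))) => m n.
by move=> /val_inj /(inj (mem_set I) (mem_set I)) /(congr1 val).
Qed.

Lemma unary_dir (xi eta : S) : exists (p1 p2 : X -> X) (zeta : S),
  xi = unary N p1 zeta /\ eta = unary N p2 zeta.
Proof.
have [e /square_injection[f finj]] := nat_injection.
have [x0 _] := base_not_surjected (@pnil X).
(* [p] inverts [f] on its range; elsewhere the default is [(x0, x0)]. *)
have /choice[p pP] :
    forall c, exists q : X * X, forall a b, f a b = c -> (a, b) = q.
  move=> c; have [[a [b fab]]|nab] := pselect (exists a b, f a b = c).
    by exists (a, b) => a' b'; rewrite -fab => /finj[-> ->].
  by exists (x0, x0) => a b fab; case: nab; exists a, b.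
pose F (v : power X 2) := f (v ord0) (v (lift ord0 ord0)).
pose v := pcons xi (pcons eta (@pnil S)).
pose vs (i : 'I_2) := Var X void i.
exists (fst \o p), (snd \o p), (ifun N F v); split; apply/esym.
(* With [xi] as the value of a variable, the goal is an instance of a transferred term equation. *)
- have -> : xi = eval N (@no_cst S) v (vs ord0).
    by rewrite /= /v /pcons unlift_none.
  apply: (@transfer 2 (Eql (fn1 (fst \o p) (App F vs)) (vs ord0))) => w /=.
  by rewrite -(pP _ _ _ erefl).
- have -> : eta = eval N (@no_cst S) v (vs (lift ord0 ord0)).
    by rewrite /= /v /pcons liftK unlift_none.
  apply: (@transfer 2 (Eql (fn1 (snd \o p) (App F vs))
    (vs (lift ord0 ord0)))) => w /=.
  by rewrite -(pP _ _ _ erefl).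
Qed.

Definition fun_ext x0 x1 : functional_extension x0 x1 S :=
  FunctionalExtension unary_incl unary_comp (unary_equ x0 x1) unary_dir.

(** Equality of whole interpretations lets Tran and Poss carry over by rewriting. Relations are
    compared through characteristic functions, which detect membership because [x0 <> x1]. *)
Lemma interp_of_fun_ext x0 x1 (x01 : x0 <> x1) :
  interp_of (fun_ext x0 x1) = ns_interp N.
Proof.
have funE n F (xi : power S n) : ext_fun (fun_ext x0 x1) F xi = ifun N F xi.
  have [[p z] /= pz] := joint_rep (fun_ext x0 x1) xi.
  have -> : xi = fun i => unary N (p i) z by apply/funext => i; rewrite -pz.
  apply: etrans (ext_funE (fun_ext x0 x1) x01 F p z) _.
  by rewrite /= /unary ifun_unary.
case: (ns_interp N) funE (@irel_chi x0 x1) => f r /= funE relE.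
congr Interpretation.
- by do 3 apply/functional_extensionality_dep => ?; exact: funE.
- apply/functional_extensionality_dep => n; apply/funext => R.
  apply/funext => xi; apply/propext; rewrite relE //.
  by rewrite /ext_rel /= funE.
Qed.

(** * Quasi-compactness of the S-topology and Poss *)

Lemma star_setS (A B : set X) : A `<=` B -> star_set N A `<=` star_set N B.
Proof.
move=> AB xi; apply: (@transfer1 _ _ N (Imp (mem_formula A) (mem_formula B))).
by move=> x /=; apply: AB.
Qed.

Lemma star_setC (A : set X) : star_set N (~` A) = ~` star_set N A.
Proof.
apply/seteqP; split=> xi.
  apply: (@transfer1 _ _ N
    (Imp (mem_formula (~` A)) (Imp (mem_formula A) (Bot _ _ _)))).
  by move=> x /=.
apply: (@transfer1 _ _ N
  (Imp (Imp (mem_formula A) (Bot _ _ _)) (mem_formula (~` A)))).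
by move=> x /=.
Qed.

Definition point_filter (xi : S) : set_system X := [set A | star_set N A xi].

Lemma point_filter_proper xi : ProperFilter (point_filter xi).
Proof.
have T (zeta : S) : star_set N setT zeta.
  exact: (@transfer1 _ _ N (mem_formula setT)).
split=> [|].
  by rewrite /point_filter /= -setCT star_setC; apply; exact: T.
split=> [|A B Axi Bxi|A B AB]; [exact: T| |exact: star_setS].
have [C [_ Cxi CAB]] := @s_base_join _ _ N A B xi I I Axi Bxi.
apply: (@transfer1 _ _ N (Imp (mem_formula A)
    (Imp (mem_formula B) (mem_formula (A `&` B)))) _ xi) => //.
Qed.

Lemma enlargement_Poss : enlargement N -> Poss N.
Proof.
move=> comp F finF; apply: contrapT => /forallNP F0.
(* An empty intersection means that the extensions of the complements cover [S]. *)
have [A FA|xi _|D DF cov] := comp (set X) F (fun A => star_set N (~` A)).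
- by apply/s_openE; exists [set ~` A]; rewrite bigcup_set1.
- have /existsNP[A /not_implyP[FA nA]] := F0 xi.
  by exists A => //=; rewrite star_setC.
(* The copy in [S] of a point common to the finitely many sets escapes the subcover. *)
have [x xD] := finF D DF.
have [A DA] := cov (incl S x) I.
by rewrite star_setC; apply; apply/(elem_rel el _ (fun=> x)); exact: (xD A DA).
Qed.

Lemma Poss_enlargement : Poss N -> enlargement N.
Proof.
move=> poss J D f fopen cov.
have [x0 _] := base_not_surjected (@pnil X).
(* This index is the default value in the choice of [i] below. *)
have [i0 _ _] := cov (incl S x0) I.
apply: contrapT => nocov.
(* A point common to the extensions of these sets lies in no basic open set contained in a cover
   member. *)
pose F := [set A : set X | exists2 i, D i & star_set N (~` A) `<=` f i].
have [|xi xiF] := poss F.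
  move=> G GF; apply: contrapT => G0.
  have /choice[i iG] :
      forall A, exists i, A \in G -> D i /\ star_set N (~` A) `<=` f i.
    move=> A; have [/GF/set_mem[i Di fi]|nAG] := boolP (A \in G).
      by exists i.
    by exists i0.
  apply: nocov; exists [fset i A | A in G]%fset.
    by move=> _ /imfsetP[A /= /iG[/mem_set DA _] ->].
  (* A point missed by the chosen members lies in the extension of every [A] in [G], so its filter
     contains the intersection of [G], which is therefore nonempty. *)
  move=> xi _; apply: contrapT => nxi.
  have FF := point_filter_proper xi.
  have : point_filter xi (\bigcap_(A in [set` G]) A).
    apply: filter_bigI => A AG.
    rewrite /point_filter /= -[A]setCK star_setC => Axi.
    apply: nxi; exists (i A); first by apply/imfsetP; exists A.
    by have [_] := iG A AG; apply.
  by move=> /filter_ex.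
have [i Di fxi] := cov xi I.
have /s_openE[B fB] := fopen i Di.
move: (fxi); rewrite fB => -[A BA Axi].
have := xiF (~` A); rewrite /= star_setC; apply=> //.
by exists i => //; rewrite setCK fB => zeta Azeta; exists A.
Qed.

End OfNonstandard.

Theorem theorem2p3 (X : Type) (x0 x1 : X) (x01 : x0 <> x1)
    (S : proper_superset X) :
  (forall N : nonstandard_extension S, enlargement N ->
     exists E : functional_extension x0 x1 S,
       [/\ star E = unary N, interp_of E = ns_interp N,
           Tran (interp_of E) & Poss (interp_of E)])
  /\
  (forall E : functional_extension x0 x1 S,
     Tran (interp_of E) -> Poss (interp_of E) ->
     exists N : nonstandard_extension S,
       [/\ ns_interp N = interp_of E, unary N = star E & enlargement N]).
Proof.
split=> [N comp|E tran poss].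
  exists (fun_ext N x0 x1); rewrite interp_of_fun_ext //; split=> //.
    exact: elementary_Tran (ns_elementary N).
  exact: enlargement_Poss.
pose N := NonstandardExtension (Tran_elementary x01 tran).
exists N; split=> //; first exact: unary_interp_of.
exact: (@Poss_enlargement _ _ N).
Qed.
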